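(* Let $A$ satisfy the standing assumptions on $A$ in the context, let $\Sigma=\{\sigma_n:n\in\mathbb Z\}$ be a partition of $\sigma(A)$, and let $Q\in\mathfrak S_2(H,\mathcal P_\Sigma)$ with $P^\Sigma_{(l)}QP^\Sigma_{(l)}\ne Q$ for all $l\in\mathbb Z_+$. Let $B\in\mathfrak L_A(H)$, and assume that there are $U\in\mathcal M^Q_\Sigma$ and $V$ such that $I+U$ is continuously invertible in $B(H)$, $(I+U)D(A)=D(A)$, $(A-B)(I+U)=(I+U)(A-V)$ on $D(A)$, and $P_{\sigma_m}VP_{\sigma_n}=0$ for $m\ne n$. For $n\in\mathbb Z_+$ let $\sigma_{(n)}=\sigma(A)\setminus\bigcup_{|m|<n}\sigma_m$, and let $\sigma'_{(n)}$ be the corresponding spectral component of $\sigma(A-B)$. Assume also that $\|U\|_\Sigma<1$ or that $\Sigma$ is the trivial partition of $\sigma(A)$ into singletons. Then $$\lim_{n\to\infty}\big\|P'_{\sigma(A-B)\setminus\sigma'_{(n)}}-P_{\sigma(A)\setminus\sigma_{(n)}}\big\|_\Sigma=\lim_{n\to\infty}\big\|P'_{\sigma'_{(n)}}-P_{\sigma_{(n)}}\big\|_\Sigma=0 .$$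
   Context: $H$ is a separable complex Hilbert space and $B(H)$ the bounded operators on $H$. Standing assumptions on $A$: $A:D(A)\subseteq H\to H$ is a closed, densely defined linear operator such that: (1) $A$ is normal, i.e. $D(A^* )=D(A)$ and $\|A^*x\|=\|Ax\|$ for $x\in D(A)$; (2) $\sigma(A)=\bigcup_{n\in\mathbb Z}\{\lambda_n\}$ with pairwise distinct $\lambda_n$, each a semisimple eigenvalue of finite multiplicity; (3) the Riesz projections $P_n=P(\{\lambda_n\},A)$ (so $AP_n=\lambda_nP_n$) are orthogonal projections with $P_mP_n=0$ for $m\ne n$, and $\sum_nP_nx$ converges unconditionally to $x$ for all $x\in H$; (4) $\sup_{j\in\mathbb Z}\sum_{n\ne j}|\lambda_n-\lambda_j|^{-2}<\infty$; (5) for every $\varepsilon>0$ there is $\lambda_\varepsilon\in\rho(A)$ with $\|(A-\lambda_\varepsilon I)^{-1}\|<\varepsilon$. $\mathfrak L_A(H)$ is the set of linear operators with domain $D(A)$ satisfying $\|Bx\|\le c(\|x\|+\|Ax\|)$ for some $c$. For $\tau\subseteq\sigma(A)$, $P_\tau=\sum_{\lambda_k\in\tau}P_k$. The spectral projection of $A-B$ corresponding to $\tau$ (with corresponding component $\tau'$ of $\sigma(A-B)$) is $P'_{\tau'}=(I+U)P_\tau(I+U)^{-1}$; in particular $P'_{\sigma(A-B)\setminus\tau'}=(I+U)P_{\sigma(A)\setminus\tau}(I+U)^{-1}$. $\mathfrak S_2(H,\mathcal P_\Sigma)$ is the space of $X\in B(H)$ with $\|X\|_\Sigma^2=\sum_{m,n\in\mathbb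 Z}\|P_{\sigma_m}XP_{\sigma_n}\|^2<\infty$ (operator norms). $P^\Sigma_{(l)}=\sum_{|n|\le l}P_{\sigma_n}$. Put $$\alpha_n(Q)=\|Q\|_\Sigma^{-1/2}\max\Big\{\Big(\sum_{|k|\ge|n|}\|P_{\sigma_k}Q\|_\Sigma^2\Big)^{1/4},\Big(\sum_{|k|\ge|n|}\|QP_{\sigma_k}\|_\Sigma^2\Big)^{1/4}\Big\},\quad n\in\mathbb Z,$$ all nonzero under the assumption on $Q$, and $f_Q(A)=\sum_n\alpha_n(Q)P_{\sigma_n}$. $\mathcal M^Q_\Sigma$ is the set of $X\in\mathfrak S_2(H,\mathcal P_\Sigma)$ such that $X=X_lf_Q(A)=f_Q(A)X_r$ for some $X_l,X_r\in\mathfrak S_2(H,\mathcal P_\Sigma)$. *)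

(* Defs.v *)
From HB Require Import structures.
From mathcomp Require Export all_boot all_order all_algebra.
From mathcomp Require Export sesquilinear.
From mathcomp Require Export complex.
From mathcomp Require Export finmap.
From mathcomp Require Export all_classical all_reals all_analysis.
From mathcomp.analysis.showcase Require Export summability.

Set Implicit Arguments.
Unset Strict Implicit.
Unset Printing Implicit Defensive.
Import Order.TTheory GRing.Theory Num.Theory Num.Def.
Export numFieldNormedType.Exports.

Local Open Scope classical_set_scope.
Local Open Scope complex_scope.
Local Open Scope ring_scope.

(* The norm of an R[i]-normed space takes its values in R[i]; nrm is the same
   number seen in R. *)
Definition nrm {R : realType} {V : normedZmodType R[i]} (x : V) : R :=
  complex.Re `|x|.

Section Operators.
Context {R : realType} {H : completeNormedModType R[i]}.
Implicit Types (X T P : H -> H).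

(* Operator norm, +oo if X is unbounded. *)
Definition opnorm X : \bar R :=
  ereal_sup [set (nrm (X x))%:E | x in [set x : H | nrm x <= 1]].

Definition bounded_op X : Prop := linear X /\ continuous X.

(* Linear operators D(A) -> H: the values of app outside dom are irrelevant. *)
Record linop := LinOp {
  dom : set H;
  app :> H -> H;
  dom0 : dom 0;
  domP : forall (a : R[i]) x y, dom x -> dom y -> dom (a *: x + y);
  appP : forall (a : R[i]) x y, dom x -> dom y ->
    app (a *: x + y) = a *: app x + app y }.

Definition closed_op (A : linop) : Prop :=
  closed [set xy : H * H | dom A xy.1 /\ xy.2 = A xy.1].

(* The inverse of the restriction of f to D (0 off the range). *)
Definition inverse_on (D : set H) T : H -> H :=
  pinv_ (fun=> 0) D T.

Definition minus_scalar (A : linop) (z : R[i]) : H -> H := fun x => A x - z *: x.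

Definition resolvent (A : linop) (z : R[i]) : H -> H :=
  inverse_on (dom A) (minus_scalar A z).

Definition resolvent_set (A : linop) : set R[i] :=
  [set z | set_bij (dom A) setT (minus_scalar A z) /\ bounded_op (resolvent A z)].

Definition spectrum (A : linop) : set R[i] := ~` resolvent_set A.

Definition eigenvalue (A : linop) (z : R[i]) : Prop :=
  exists x, [/\ dom A x, x != 0 & A x = z *: x].

(* The integral of an operator-valued function F along gamma : [a, b] -> C,
   as the limit in operator norm of its Riemann-Stieltjes sums over tagged
   subdivisions t_0 <= s_0 <= t_1 <= ... <= t_N of [a, b]. *)
Definition is_contour_integral (F : R[i] -> H -> H) (gamma : R -> R[i])
    (a b : R) (S : H -> H) : Prop :=
  forall e : R, 0 < e -> exists2 d : R, 0 < d &
    forall (N : nat) (t s : nat -> R), t 0%N = a -> t N = b ->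
      (forall k, (k < N)%N -> t k <= s k <= t k.+1 /\ t k.+1 - t k < d) ->
      (opnorm (fun x =>
         \sum_(k < N) ((gamma (t k.+1) - gamma (t k)) *: F (gamma (s k)) x)
         - S x)%R < e%:E)%E.

Definition circle (z : R[i]) (r : R) (t : R) : R[i] :=
  z + (r * cos t +i* (r * sin t)).

(* P is the Riesz projection P({z}, A) at an isolated point z of the spectrum:
   P = - (2 pi i)^-1 \oint (A - w)^-1 dw over a circle around z. *)
Definition is_riesz_projection (A : linop) (z : R[i]) P : Prop :=
  exists r : R, [/\ 0 < r,
    forall w, nrm (w - z) <= r -> w != z -> resolvent_set A w &
    exists2 S, is_contour_integral (resolvent A) (circle z r) 0 (pi *+ 2) S &
      forall x, P x = - ((pi *+ 2)%:C * 'i%C)^-1 *: S x].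

(* P is the Riesz projection at z; semisimplicity is the vanishing of the
   eigennilpotent (A - z) P. *)
Definition semisimple_eigenvalue (A : linop) (z : R[i]) P : Prop :=
  eigenvalue A z /\ forall x, dom A (P x) /\ A (P x) = z *: P x.

Definition finite_rank P : Prop :=
  exists s : seq H, forall x, exists c : nat -> R[i],
    P x = \sum_(k < size s) c k *: s`_k.

Section InnerProduct.
Variable ip : H -> H -> R[i].

Definition adjoint_rel (A : linop) (y z : H) : Prop :=
  forall x, dom A x -> ip (A x) y = ip x z.

Definition adjoint_dom (A : linop) : set H :=
  [set y | exists z, adjoint_rel A y z].

Definition adjoint (A : linop) (y : H) : H := xget 0 (adjoint_rel A y).

Definition normal_op (A : linop) : Prop :=
  adjoint_dom A = dom A /\
  forall x, dom A x -> `|adjoint A x| = `|A x|.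

Definition orthogonal_projection P : Prop :=
  [/\ bounded_op P, forall x, P (P x) = P x &
      forall x y, ip (P x) y = ip x (P y)].

(* lam enumerates the spectrum of A and P n is the Riesz projection at lam n. *)
Record standing_assumptions (A : linop) (lam : int -> R[i])
    (P : int -> H -> H) : Prop := StandingAssumptions {
  sa_closed : closed_op A;
  sa_dense : dense (dom A);
  sa_normal : normal_op A;
  sa_spectrum : spectrum A = range lam;
  sa_lam_inj : injective lam;
  sa_riesz : forall n, is_riesz_projection A (lam n) (P n);
  sa_semisimple : forall n, semisimple_eigenvalue A (lam n) (P n);
  sa_mult : forall n, finite_rank (P n);
  sa_orth : forall n, orthogonal_projection (P n);
  sa_disj : forall m n, m != n -> forall x, P m (P n x) = 0;
  sa_sum : forall x, partial_sum (fun n => P n x) @ totally --> x;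
  sa_gap : (ereal_sup [set \esum_(n in [set n : int | n != j])
                ((nrm (lam n - lam j)%R) ^- 2)%:E | j in [set: int]] < +oo)%E;
  sa_resolvent : forall e : R, 0 < e -> exists2 z,
    resolvent_set A z & (opnorm (resolvent A z) < e%:E)%E }.

End InnerProduct.

(* P_tau = \sum_(lam_k \in tau) P_k, as an unconditional strong sum. *)
Definition proj_on (lam : int -> R[i]) (P : int -> H -> H) (tau : set R[i]) :
    H -> H :=
  fun x => summability.sum (fun k : int => if `[< tau (lam k) >] then P k x else 0).

Definition block_proj (lam : int -> R[i]) (P : int -> H -> H)
    (sigma : int -> set R[i]) : int -> H -> H :=
  fun n => proj_on lam P (sigma n).

(* The sets sigma_(n). *)
Definition sigma_tail (A : linop) (sigma : int -> set R[i]) (n : nat) :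
    set R[i] :=
  spectrum A `\` \bigcup_(m in [set m : int | (absz m < n)%N]) sigma m.

(* The class L_A(H). *)
Definition rel_bounded (A B : linop) : Prop :=
  dom B = dom A /\
  exists c : R, forall x, dom A x -> nrm (B x) <= c * (nrm x + nrm (A x)).

(* E n stands for P_(sigma_n). *)
Section Sigma.
Variable E : int -> H -> H.

Definition Snorm2 X : \bar R :=
  \esum_(mn in [set: int * int]) (opnorm (E mn.1 \o X \o E mn.2) ^+ 2)%E.

Definition S2 : set (H -> H) :=
  [set X | bounded_op X /\ (Snorm2 X < +oo)%E].

(* Meaningful on S2 only. *)
Definition Snorm X : R := Num.sqrt (fine (Snorm2 X)).

Definition Psum (l : nat) : H -> H :=
  fun x => \sum_(n \in [set n : int | (absz n <= l)%N]) E n x.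

Definition tail (F : int -> H -> H) (n : int) : R :=
  fine (\esum_(k in [set k : int | (absz n <= absz k)%N])
    ((Snorm (F k)) ^+ 2)%:E).

Definition alpha (Q : H -> H) (n : int) : R :=
  Snorm Q `^ (- 2^-1) *
  Num.max (tail (fun k => E k \o Q) n `^ 4^-1)
          (tail (fun k => Q \o E k) n `^ 4^-1).

Definition fQ (Q : H -> H) : H -> H :=
  fun x => summability.sum (fun n : int => (alpha Q n)%:C *: E n x).

Definition MQ (Q : H -> H) : set (H -> H) :=
  [set X | S2 X /\ exists Xl Xr,
     [/\ S2 Xl, S2 Xr, X = Xl \o fQ Q & X = fQ Q \o Xr]].

End Sigma.

Definition idplus (U : H -> H) : H -> H := fun x => x + U x.

Definition continuously_invertible T : Prop :=
  exists W, [/\ bounded_op W, cancel T W & cancel W T].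

(* For a spectral projection Ptau of A and A - B similar to A - V via I + U,
   the spectral projection of A - B onto the corresponding component. *)
Definition perturbed_proj (U Ptau : H -> H) : H -> H :=
  idplus U \o Ptau \o inverse_on setT (idplus U).

End Operators.

Arguments linop {R} H.

(* Main.v *)
From HB Require Import structures.
Require Import Defs.
From mathcomp Require Import ring lra.

(** Conjugating a cut-off [Pi] of the block decomposition by [I + U] moves it by
[(I + U) Pi (I + U)^-1 - Pi = (U Pi - Pi U) (I + U)^-1], so the proof rests on
two facts about the norm [X |-> (\sum_(m, n) |E_m X E_n|^2)^(1/2)].

Firstly, the entries of the commutator of [U] with the cut-off at level [n] are
dominated by those of [U] and vanish on the square where both indices are below
[n]; the norm of the commutator is therefore at most a tail of a convergent
double series and tends to [0] (lemma [commutator_small]).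

Secondly, [(I + U)^-1 - I] again has finite norm (lemma [hs_le_inverse]).
Bounded operators times operators of finite norm may fail to have finite norm
when the blocks are infinite dimensional, so this is more than the identity
[(I + U)^-1 - I = - U (I + U)^-1]. The norm is however submultiplicative (lemma
[hs_leM]), and [U] differs from a finite block [Pi U Pi] by an operator [- Z] of
norm less than [1]. For [W = (I + U)^-1 - I] this gives an equation
[W Pi = Y + Z (W Pi)] with [Y] of finite norm, and then an equation
[W = Y' + W Z]: in both, the Neumann series of [Z] bounds the unknown.
Submultiplicativity then bounds the norm of [(U Pi - Pi U) (I + U)^-1] by that
of the commutator times [1] plus the norm of [W].

The tails [sigma_(n)] are handled by complementation, since their projection is
[I - Pi] and the corresponding difference is the opposite of the former one.
What the normal operator contributes is its orthogonal resolution of the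
identity: the projections onto unions of eigenspaces are determined by their
components, hence satisfy the Boolean calculus of index sets, and Pythagoras
passes to them from the finite sums (lemma [blocks_decomposition]). *)

Set Implicit Arguments.
Unset Strict Implicit.
Unset Printing Implicit Defensive.
Import Order.TTheory GRing.Theory Num.Theory.
Local Open Scope classical_set_scope.
Local Open Scope complex_scope.
Local Open Scope ring_scope.

(** * Real-valued norms and bounded operators *)

Section RealNorm.
Context {R : realType} {V : normedModType R[i]}.
Implicit Types x y : V.

Lemma normE x : `|x| = (nrm x)%:C.
Proof. by rewrite /nrm RRe_real ?normr_real. Qed.

Lemma nrm_ge0 x : 0 <= nrm x.
Proof. by rewrite -lecR -normE normr_ge0. Qed.

Lemma nrm0 : nrm (0 : V) = 0.
Proof. by rewrite /nrm normr0. Qed.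

Lemma nrmN x : nrm (- x) = nrm x.
Proof. by rewrite /nrm normrN. Qed.

Lemma nrmD x y : nrm (x + y) <= nrm x + nrm y.
Proof. by rewrite -lecR rmorphD /= -!normE ler_normD. Qed.

Lemma nrm_sum (I : Type) (r : seq I) (F : I -> V) :
  nrm (\sum_(i <- r) F i) <= \sum_(i <- r) nrm (F i).
Proof.
elim/big_ind2: _ => [|a b c d Hab Hcd|//]; first by rewrite nrm0.
exact: le_trans (nrmD _ _) (lerD _ _).
Qed.

Lemma nrmZ (a : R) x : nrm (a%:C *: x) = `|a| * nrm x.
Proof.
have /(congr1 (@complex.Re R)) : `|a%:C *: x| = (`|a| * nrm x)%:C.
  by rewrite normrZ normE rmorphM /= normc_def /= expr0n addr0 sqrtr_sqr.
by [].
Qed.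

Lemma nrm_eq0 x : nrm x = 0 -> x = 0.
Proof. by move=> x0; apply/normr0_eq0; rewrite normE x0. Qed.

End RealNorm.

Section BoundedOperators.
Context {R : realType} {H : completeNormedModType R[i]}.
Implicit Types (X Y T : H -> H).

Section Linear.
Variables (X : H -> H) (linX : linear X).
Let f : {linear H -> H} := HB.pack X (GRing.isLinear.Build _ _ _ _ X linX).

Lemma lin0 : X 0 = 0. Proof. exact: (linear0 f). Qed.
Lemma linD x y : X (x + y) = X x + X y. Proof. exact: (linearD f). Qed.
Lemma linN x : X (- x) = - X x. Proof. exact: (linearN f). Qed.
Lemma linB x y : X (x - y) = X x - X y. Proof. exact: (linearB f). Qed.
Lemma linZ a x : X (a *: x) = a *: X x. Proof. exact: (linearZ_LR f). Qed.
Lemma lin_sum (I : Type) (r : seq I) (F : I -> H) :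
  X (\sum_(i <- r) F i) = \sum_(i <- r) X (F i).
Proof. exact: (linear_sum f). Qed.

Lemma linear_continuousP :
  continuous X <-> exists2 c : R, 0 <= c & forall x, nrm (X x) <= c * nrm x.
Proof.
split=> [cX|[c c0 hc]].
  have /linear_boundedP/pinfty_ex_gt0[M M0 hM] : bounded_near f (nbhs 0).
    exact/(linear_bounded_continuous f).
  have eM : M = (complex.Re M)%:C by rewrite RRe_real// gtr0_real.
  exists (complex.Re M) => [|x]; first by rewrite -lecR -eM ltW.
  by rewrite -lecR rmorphM /= -eM -!normE; exact: hM.
apply/(linear_bounded_continuous f)/linear_boundedP.
exists c%:C; split=> [|r cr x]; first by apply/complex_realP; exists c.
apply: (@le_trans _ _ (c%:C * `|x|)).
  by rewrite !normE -rmorphM /= lecR; exact: hc.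
by rewrite ler_wpM2r// ltW.
Qed.

End Linear.

Lemma bounded_opP X : bounded_op X <->
  linear X /\ exists2 c : R, 0 <= c & forall x, nrm (X x) <= c * nrm x.
Proof. by split=> -[lX /(linear_continuousP lX)]. Qed.

Lemma bounded_lin X : bounded_op X -> linear X.
Proof. by case. Qed.

Lemma bounded_comp X Y : bounded_op X -> bounded_op Y -> bounded_op (X \o Y).
Proof.
move=> /bounded_opP[lX [a a0 hX]] /bounded_opP[lY [b b0 hY]].
apply/bounded_opP; split=> [k x y /=|]; first by rewrite lY lX.
exists (a * b) => [|x /=]; first exact: mulr_ge0.
by rewrite (le_trans (hX _))// -mulrA ler_wpM2l.
Qed.

Lemma bounded_add X Y :
  bounded_op X -> bounded_op Y -> bounded_op (fun x => X x + Y x).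
Proof.
move=> /bounded_opP[lX [a a0 hX]] /bounded_opP[lY [b b0 hY]].
apply/bounded_opP; split=> [k x y /=|].
  by rewrite lY lX scalerDr addrACA.
exists (a + b) => [|x /=]; first exact: addr_ge0.
by rewrite (le_trans (nrmD _ _))// mulrDl lerD.
Qed.

Lemma bounded_opp X : bounded_op X -> bounded_op (fun x => - X x).
Proof.
move=> /bounded_opP[lX [a a0 hX]]; apply/bounded_opP; split=> [k x y /=|].
  by rewrite lX opprD scalerN.
by exists a => // x /=; rewrite nrmN.
Qed.

Lemma bounded_sub X Y :
  bounded_op X -> bounded_op Y -> bounded_op (fun x => X x - Y x).
Proof. by move=> bX /bounded_opp; exact: bounded_add. Qed.

Lemma bounded_zero : bounded_op (fun=> 0 : H).
Proof.
apply/bounded_opP; split=> [k x y|]; first by rewrite scaler0 addr0.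
by exists 0 => // x; rewrite nrm0 mul0r.
Qed.

Definition onrm X : R := fine (opnorm X).

Lemma opnorm_ge0 X : (0 <= opnorm X)%E.
Proof.
apply: (@le_trans _ _ (nrm (X 0))%:E); first by rewrite lee_fin nrm_ge0.
by apply: ereal_sup_ubound; exists 0 => //=; rewrite nrm0.
Qed.

Lemma opnorm_le X c : 0 <= c -> (forall x, nrm (X x) <= c * nrm x) ->
  (opnorm X <= c%:E)%E.
Proof.
move=> c0 hc; apply: ge_ereal_sup => _ [x /= x1 <-].
by rewrite lee_fin (le_trans (hc x))// -[leRHS]mulr1 ler_wpM2l.
Qed.

Lemma onrm_ge0 X : 0 <= onrm X.
Proof. exact/fine_ge0/opnorm_ge0. Qed.

Lemma opnormE X : bounded_op X -> opnorm X = (onrm X)%:E.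
Proof.
move=> /bounded_opP[_ [c c0 /(opnorm_le c0) hc]].
by rewrite fineK// ge0_fin_numE ?opnorm_ge0// (le_lt_trans hc) ?ltry.
Qed.

Lemma onrm_le X c : 0 <= c -> (forall x, nrm (X x) <= c * nrm x) -> onrm X <= c.
Proof.
move=> c0 /(opnorm_le c0) hc; rewrite -lee_fin fineK//.
by rewrite ge0_fin_numE ?opnorm_ge0// (le_lt_trans hc) ?ltry.
Qed.

Lemma le_onrm X x : bounded_op X -> nrm (X x) <= onrm X * nrm x.
Proof.
move=> bX; have lX := bounded_lin bX.
have [/nrm_eq0 ->|x0] := eqVneq (nrm x) 0; first by rewrite lin0// nrm0 mulr0.
have xgt0 : 0 < nrm x by rewrite lt_neqAle eq_sym x0 nrm_ge0.
have : ((nrm (X ((nrm x)^-1%:C *: x)))%:E <= opnorm X)%E.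
  apply: ereal_sup_ubound; exists ((nrm x)^-1%:C *: x) => //=.
  by rewrite nrmZ ger0_norm ?invr_ge0 ?nrm_ge0// mulVf.
rewrite opnormE// lee_fin linZ// nrmZ ger0_norm ?invr_ge0 ?nrm_ge0//.
by rewrite ler_pdivrMl// mulrC.
Qed.

End BoundedOperators.

(** * Square-summable arrays *)

Section Arrays.
Context {R : realType}.

(** Cauchy-Schwarz, with the two square sums replaced by upper bounds: sum the
inequalities [a i * b i <= (t * a i ^+ 2 + b i ^+ 2 / t) / 2] for a [t] close
to [B / A]. *)
Lemma sum_mul_le (I : Type) (s : seq I) (a b : I -> R) (A B : R) :
  0 <= A -> 0 <= B ->
  \sum_(i <- s) a i ^+ 2 <= A ^+ 2 -> \sum_(i <- s) b i ^+ 2 <= B ^+ 2 ->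
  \sum_(i <- s) a i * b i <= A * B.
Proof.
move=> A0 B0 hA hB; apply/ler_addgt0Pr => e e0.
(* The shift by [d] keeps [t] meaningful when [A] or [B] is zero. *)
pose d := e / (A + B + 1); have D0 : 0 < A + B + 1 by lra.
have d0 : 0 < d by exact: divr_gt0.
have de : d * (A + B) <= e.
  by rewrite -[leRHS](divfK (lt0r_neq0 D0)) -/d ler_pM2l//; lra.
have Ad : 0 < A + d by exact: ltr_wpDl.
have Bd : 0 < B + d by exact: ltr_wpDl.
pose t := (B + d) / (A + d); have t0 : 0 < t by exact: divr_gt0.
have le i : a i * b i <= (a i ^+ 2 * t + b i ^+ 2 / t) / 2.
  have : 0 <= (a i * t - b i) ^+ 2 / t / 2 by rewrite !divr_ge0 ?sqr_ge0 ?ltW.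
  rewrite (_ : _ / 2 = (a i ^+ 2 * t + b i ^+ 2 / t) / 2 - a i * b i).
    by rewrite subr_ge0.
  by field; rewrite gt_eqF.
apply: (le_trans (ler_sum _ (fun i _ => le i))).
rewrite -mulr_suml big_split /= -!mulr_suml.
have hAt : A ^+ 2 * t <= A * (B + d).
  rewrite expr2 -mulrA ler_wpM2l// mulrA ler_pdivrMr// mulrC.
  by rewrite ler_wpM2l ?(ltW Bd)// lerDl ltW.
have hBt : B ^+ 2 / t <= B * (A + d).
  rewrite expr2 -mulrA ler_wpM2l// invf_div mulrA ler_pdivrMr// mulrC.
  by rewrite ler_wpM2l ?(ltW Ad)// lerDl ltW.
have := le_trans (ler_wpM2r (ltW t0) hA) hAt.
have : (\sum_(i <- s) b i ^+ 2) / t <= B * (A + d).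
  by apply: le_trans hBt; rewrite ler_wpM2r// invr_ge0 ltW.
by lra.
Qed.

(** Minkowski's inequality, in the form in which it bounds sums of arrays. *)
Lemma sum_sqrD_le (I : Type) (s : seq I) (a b : I -> R) (A B : R) :
  0 <= A -> 0 <= B ->
  \sum_(i <- s) a i ^+ 2 <= A ^+ 2 -> \sum_(i <- s) b i ^+ 2 <= B ^+ 2 ->
  \sum_(i <- s) (a i + b i) ^+ 2 <= (A + B) ^+ 2.
Proof.
move=> A0 B0 hA hB; have hAB := sum_mul_le A0 B0 hA hB.
rewrite (eq_bigr (fun i => a i ^+ 2 + b i ^+ 2 + (a i * b i) * 2)); last first.
  by move=> i _; ring.
rewrite !big_split /= -mulr_suml.
by rewrite (_ : (A + B) ^+ 2 = A ^+ 2 + B ^+ 2 + A * B * 2); [lra|ring].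
Qed.

Lemma sum_fset_sub (T : choiceType) (F G : {fset T}) (a : T -> R) :
  (forall i, 0 <= a i) -> {subset F <= G} ->
  \sum_(i <- F) a i <= \sum_(i <- G) a i.
Proof.
move=> a0 FG; rewrite (big_fsetID _ (mem F) G) /=.
rewrite (_ : [fset x | x in G & x \in F]%fset = F).
  by rewrite lerDl sumr_ge0.
apply/fsetP => i; rewrite !inE /=.
by case: (boolP (i \in F)) => [/FG->|]; rewrite ?andbF.
Qed.

Lemma sum_fsetM (T1 T2 : choiceType) (M : {fset T1}) (N : {fset T2})
    (a : T1 -> T2 -> R) :
  \sum_(p <- (M `*` N)%fset) a p.1 p.2 = \sum_(m <- M) \sum_(n <- N) a m n.
Proof.
rewrite -(big_allpairs (r1 := M) (r2 := N) (F := fun p => a p.1 p.2)).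
apply/perm_big/uniq_perm; first exact: fset_uniq.
  by rewrite allpairs_uniq ?fset_uniq// => -[? ?] [? ?].
move=> [m n]; rewrite in_fsetM /=; apply/andP/allpairsP.
  by case=> mM nN; exists (m, n).
by case=> -[m' n'] /= [? ? [-> ->]].
Qed.

(** The row sums are taken in the extended reals, where finite and infinite sums
commute; the bound on the partial sums then makes them finite. *)
Lemma row_sums (T1 T2 : choiceType) (a : T1 -> T2 -> R) (C : R) :
  (forall m n, 0 <= a m n) ->
  (forall F : {fset T1 * T2}, \sum_(p <- F) a p.1 p.2 <= C) ->
  exists r : T1 -> R, [/\ forall m, 0 <= r m,
    forall m (K : {fset T2}), \sum_(k <- K) a m k <= r m &
    forall M : {fset T1}, \sum_(m <- M) r m <= C].
Proof.
move=> a0 hC.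
have sumM (M : {fset T1}) :
    (\sum_(m <- M) \esum_(k in [set: T2]) (a m k)%:E <= C%:E)%E.
  rewrite -(@esum_sum _ _ _ _ _ xpredT (fun k m => (a m k)%:E)); last first.
    by move=> *; rewrite lee_fin.
  apply: ge_ereal_sup => _ [Y [finY _] <-].
  rewrite fsbig_finite//=; under eq_bigr do rewrite sumEFin.
  by rewrite sumEFin exchange_big -sum_fsetM lee_fin.
have row_fin m : (\esum_(k in [set: T2]) (a m k)%:E) \is a fin_num.
  rewrite ge0_fin_numE ?esum_ge0// => [|k _]; last by rewrite lee_fin.
  have := sumM [fset m]%fset; rewrite big_seq_fset1 => /le_lt_trans; apply.
  by rewrite ltry.
exists (fun m => fine (\esum_(k in [set: T2]) (a m k)%:E)); split.
- by move=> m; apply/fine_ge0/esum_ge0 => k _; rewrite lee_fin.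
- move=> m K; rewrite -lee_fin fineK// -sumEFin; apply: esum_ge.
  exists [set` K]; first by split.
  by rewrite fsbig_seq ?fset_uniq.
- move=> M; rewrite -lee_fin -sumEFin.
  by under eq_bigr do rewrite fineK//.
Qed.
End Arrays.

(** * Operators with square-summable blocks *)

Section HilbertSchmidt.
Context {R : realType} {H : completeNormedModType R[i]}.

(** Orthogonality enters only through Pythagoras and contractivity of finite
sums, so the inner product does not appear. Totality asks for some
approximating finite sum rather than for unconditional convergence. *)
Record orthogonal_decomposition (E : int -> H -> H) : Prop := {
  od_lin : forall n, linear (E n);
  od_comp : forall m n x, E m (E n x) = if m == n then E n x else 0;
  od_pyth : forall (G : {fset int}) x,
    nrm (\sum_(k <- G) E k x) ^+ 2 = \sum_(k <- G) nrm (E k x) ^+ 2;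
  od_contr : forall (G : {fset int}) x, nrm (\sum_(k <- G) E k x) <= nrm x;
  od_total : forall x (e : R), 0 < e ->
    exists G : {fset int}, nrm (x - \sum_(k <- G) E k x) < e }.

Variables (E : int -> H -> H) (odE : orthogonal_decomposition E).
Implicit Types (X Y Z T : H -> H).

Definition entry X (m n : int) : R := onrm (E m \o X \o E n).

(** The ball of radius [c] of the norm [Snorm E]. Working with bounds on finite
partial sums postpones every question of finiteness of the norm. *)
Definition hs_le X (c : R) : Prop :=
  [/\ bounded_op X, 0 <= c &
    forall F : {fset int * int}, \sum_(p <- F) entry X p.1 p.2 ^+ 2 <= c ^+ 2].

Lemma od_contr1 n x : nrm (E n x) <= nrm x.
Proof. by have := od_contr odE [fset n]%fset x; rewrite big_seq_fset1. Qed.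

Lemma od_bounded n : bounded_op (E n).
Proof.
apply/bounded_opP; split; first exact: od_lin.
by exists 1 => // x; rewrite mul1r od_contr1.
Qed.

Lemma entry_bounded X m n : bounded_op X -> bounded_op (E m \o X \o E n).
Proof. move=> bX; apply: bounded_comp (od_bounded n).
exact: bounded_comp (od_bounded m) bX. Qed.

Lemma entry_ge0 X m n : 0 <= entry X m n.
Proof. exact: onrm_ge0. Qed.

Lemma le_entry X m n x : bounded_op X ->
  nrm (E m (X (E n x))) <= entry X m n * nrm x.
Proof. by move=> /(entry_bounded m n) /le_onrm; exact. Qed.

Lemma entry_le X m n c : 0 <= c ->
  (forall x, nrm (E m (X (E n x))) <= c * nrm x) -> entry X m n <= c.
Proof. by move=> c0 hc; exact: onrm_le. Qed.

Lemma S2_hs_le X : S2 E X -> hs_le X (Snorm E X).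
Proof.
move=> [bX]; rewrite /Snorm /Snorm2; set S := (\esum_(_ in _) _)%E => fin.
have S0 : (0 <= S)%E by apply: esum_ge0 => p _; exact: sqre_ge0.
split=> [//||F]; first exact: sqrtr_ge0.
rewrite sqr_sqrtr ?fine_ge0// -lee_fin fineK ?ge0_fin_numE// -sumEFin.
apply: esum_ge; exists [set` F]; first by split.
rewrite -fsbig_seq ?fset_uniq// lee_sum// => p _.
by rewrite opnormE ?EFin_expe//; exact: entry_bounded.
Qed.

Lemma Snorm2_le X c : hs_le X c -> (Snorm2 E X <= (c ^+ 2)%:E)%E.
Proof.
move=> [bX c0 hc]; apply: ge_ereal_sup => _ [Y [finY _] <-].
rewrite fsbig_finite//=.
rewrite (eq_bigr (fun p => (entry X p.1 p.2 ^+ 2)%:E)) ?sumEFin ?lee_fin//.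
by move=> p _; rewrite opnormE ?EFin_expe//; exact: entry_bounded.
Qed.

Lemma hs_le_S2 X c : hs_le X c -> S2 E X.
Proof.
by move=> hX; split; [case: hX|rewrite (le_lt_trans (Snorm2_le hX)) ?ltry].
Qed.

Lemma Snorm_le X c : hs_le X c -> Snorm E X <= c.
Proof.
move=> hX; have c0 : 0 <= c by case: hX.
rewrite -[leRHS]ger0_norm// -sqrtr_sqr; apply: ler_wsqrtr.
have [_ fin] := hs_le_S2 hX; rewrite -lee_fin fineK ?Snorm2_le//.
by rewrite ge0_fin_numE// esum_ge0// => p _; exact: sqre_ge0.
Qed.

Lemma hs_le_entry X Y c : bounded_op X -> hs_le Y c ->
  (forall m n, entry X m n <= entry Y m n) -> hs_le X c.
Proof.
move=> bX [bY c0 hc] XY; split=> // F; apply: le_trans (hc F).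
by apply: ler_sum => p _; rewrite lerXn2r ?nnegrE ?entry_ge0.
Qed.

Lemma hs_le0 c : 0 <= c -> hs_le (fun=> 0) c.
Proof.
move=> c0; split=> [|//|F]; first exact: bounded_zero.
rewrite big1 ?sqr_ge0// => p _; apply/eqP; rewrite sqrf_eq0 eq_le entry_ge0.
rewrite entry_le// => x; rewrite (lin0 (od_lin odE _)) nrm0 mul0r.
exact: lexx.
Qed.

Lemma hs_leD X Y a b : hs_le X a -> hs_le Y b ->
  hs_le (fun x => X x + Y x) (a + b).
Proof.
move=> [bX a0 ha] [bY b0 hb]; split=> [||F]; first exact: bounded_add.
  exact: addr_ge0.
apply: le_trans (sum_sqrD_le a0 b0 (ha F) (hb F)).
apply: ler_sum => p _; rewrite lerXn2r ?nnegrE ?addr_ge0 ?entry_ge0//.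
apply: entry_le => [|x]; first by rewrite addr_ge0 ?entry_ge0.
rewrite (linD (od_lin odE _)) (le_trans (nrmD _ _))// mulrDl.
by rewrite lerD// le_entry.
Qed.

Lemma hs_leN X a : hs_le X a -> hs_le (fun x => - X x) a.
Proof.
move=> hX; have [bX _ _] := hX; apply: (hs_le_entry _ hX).
  exact: bounded_opp.
move=> m n; apply: entry_le => [|x]; first exact: entry_ge0.
by rewrite (linN (od_lin odE _)) nrmN le_entry.
Qed.

Lemma S2N X : S2 E X -> S2 E (fun x => - X x).
Proof. by move=> hX; exact (hs_le_S2 (hs_leN (S2_hs_le hX))). Qed.

Lemma SnormN X : S2 E X -> Snorm E (fun x => - X x) = Snorm E X.
Proof.
have le_N Y : S2 E Y -> Snorm E (fun x => - Y x) <= Snorm E Y.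
  by move=> hY; apply: Snorm_le; exact (hs_leN (S2_hs_le hY)).
move=> hX; apply/le_anti; rewrite le_N//=.
rewrite [Y in Snorm E Y <= _](_ : _ = fun x => - - X x).
  by rewrite le_N//; exact: S2N.
by apply/funext => x; rewrite opprK.
Qed.

Lemma hs_leB X Y a b : hs_le X a -> hs_le Y b ->
  hs_le (fun x => X x - Y x) (a + b).
Proof. by move=> hX /hs_leN; exact: hs_leD. Qed.

Lemma bessel (G : {fset int}) x :
  \sum_(k <- G) nrm (E k x) ^+ 2 <= nrm x ^+ 2.
Proof.
by rewrite -(od_pyth odE) lerXn2r ?nnegrE ?nrm_ge0//; exact: od_contr odE _ _.
Qed.

(** Expanding [z] in its components turns [E m (X z)] into the pairing of the
[m]-th row of [X] with these components, to which Cauchy-Schwarz applies. *)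
Lemma row_apply X m z (r s : R) : bounded_op X -> 0 <= r -> 0 <= s ->
  (forall K : {fset int}, \sum_(k <- K) entry X m k ^+ 2 <= r ^+ 2) ->
  (forall K : {fset int}, \sum_(k <- K) nrm (E k z) ^+ 2 <= s ^+ 2) ->
  nrm (E m (X z)) <= r * s.
Proof.
move=> bX r0 s0 hr hs; apply/ler_addgt0Pl => e e0.
have := bounded_comp (od_bounded m) bX; rewrite -[E m _]/((E m \o X) z).
have leE k x : nrm ((E m \o X) (E k x)) <= entry X m k * nrm x.
  exact: le_entry.
move: (E m \o X) leE => T leE bT; have lT := bounded_lin bT.
have c0 : 0 < onrm T + 1 by rewrite ltr_wpDl ?onrm_ge0.
have [G hG] := od_total odE z (divr_gt0 e0 c0).
rewrite -[z in leLHS](subrK (\sum_(k <- G) E k z)) linD//.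
rewrite (le_trans (nrmD _ _))// lerD//.
  rewrite (le_trans (le_onrm _ bT))// -[leRHS](divfK (lt0r_neq0 c0)) mulrC.
  by rewrite ler_pM ?onrm_ge0 ?nrm_ge0 ?lerDl// ltW.
rewrite lin_sum//; apply: le_trans (nrm_sum _ _) _.
apply: le_trans (sum_mul_le r0 s0 (hr G) (hs G)).
apply: ler_sum => k _.
have -> : E k z = E k (E k z) by rewrite (od_comp odE) eqxx.
by apply: le_trans (leE _ _) _; rewrite [in leRHS](od_comp odE) eqxx.
Qed.

Lemma hs_le_rows X c : hs_le X c -> exists r : int -> R,
  [/\ forall m, 0 <= r m,
      forall m (K : {fset int}), \sum_(k <- K) entry X m k ^+ 2 <= r m ^+ 2 &
      forall M : {fset int}, \sum_(m <- M) r m ^+ 2 <= c ^+ 2].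
Proof.
move=> [bX c0 hc].
have [|r [r0 hr hM]] := row_sums (a := fun m n => entry X m n ^+ 2) _ hc.
  by move=> m n; exact: sqr_ge0.
exists (fun m => Num.sqrt (r m)); split=> [m|m K|M]; first exact: sqrtr_ge0.
  by rewrite sqr_sqrtr.
by under eq_bigr do rewrite sqr_sqrtr//.
Qed.

Lemma hs_le_cols X c : hs_le X c -> exists r : int -> R,
  [/\ forall n, 0 <= r n,
      forall n (K : {fset int}), \sum_(k <- K) entry X k n ^+ 2 <= r n ^+ 2 &
      forall N : {fset int}, \sum_(n <- N) r n ^+ 2 <= c ^+ 2].
Proof.
move=> [bX c0 hc].
have [||r [r0 hr hM]] :=
    row_sums (a := fun n m => entry X m n ^+ 2) (C := c ^+ 2).
- by move=> m n; exact: sqr_ge0.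
- move=> F; apply: le_trans (hc [fset (p.2, p.1) | p in F]%fset).
  by rewrite big_imfset//= => -[? ?] [? ?] _ _ [-> ->].
exists (fun m => Num.sqrt (r m)); split=> [m|m K|M]; first exact: sqrtr_ge0.
  by rewrite sqr_sqrtr.
by under eq_bigr do rewrite sqr_sqrtr//.
Qed.

(** Sum the bounds of [row_apply] over the rows, and use Pythagoras on both
sides. *)
Lemma hs_le_opnorm X c x : hs_le X c -> nrm (X x) <= c * nrm x.
Proof.
move=> hX; have [bX c0 _] := hX; have [r [r0 hr hM]] := hs_le_rows hX.
apply/ler_addgt0Pl => e /(od_total odE (X x))[G hG].
rewrite -[X x in leLHS](subrK (\sum_(k <- G) E k (X x))).
rewrite (le_trans (nrmD _ _))// lerD ?(ltW hG)//.
rewrite -(@ler_pXn2r _ 2)// ?nnegrE ?mulr_ge0 ?nrm_ge0// (od_pyth odE).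
rewrite exprMn (@le_trans _ _ (\sum_(k <- G) r k ^+ 2 * nrm x ^+ 2))//.
  apply: ler_sum => k _; rewrite -exprMn lerXn2r ?nnegrE ?mulr_ge0 ?nrm_ge0//.
  apply: row_apply => // [|K]; first exact: nrm_ge0.
  exact: bessel.
by rewrite -mulr_suml ler_wpM2r ?sqr_ge0.
Qed.

(** By [row_apply] with [z = Y (E n x)], the entry of the product at [(m, n)] is
at most the product of the [m]-th row norm of [X] and the [n]-th column norm of
[Y]. *)
Lemma hs_leM X Y a b : hs_le X a -> hs_le Y b -> hs_le (X \o Y) (a * b).
Proof.
move=> hX hY; have [bX a0 _] := hX; have [bY b0 _] := hY.
have [r [r0 hr hM]] := hs_le_rows hX; have [s [s0 hs hN]] := hs_le_cols hY.
split=> [||F]; [exact: bounded_comp|exact: mulr_ge0|].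
have le_rs m n : entry (X \o Y) m n <= r m * s n.
  apply: entry_le => [|x /=]; first exact: mulr_ge0.
  rewrite -mulrA; apply: row_apply => // [|K].
    by rewrite mulr_ge0 ?nrm_ge0.
  apply: (@le_trans _ _ (\sum_(k <- K) entry Y k n ^+ 2 * nrm x ^+ 2)).
    apply: ler_sum => k _; rewrite -exprMn lerXn2r ?nnegrE ?nrm_ge0//.
      by rewrite mulr_ge0 ?nrm_ge0 ?entry_ge0.
    exact: le_entry.
  by rewrite -mulr_suml exprMn ler_wpM2r ?sqr_ge0.
pose M := [fset p.1 | p in F]%fset; pose N := [fset p.2 | p in F]%fset.
apply: (@le_trans _ _ (\sum_(p <- F) r p.1 ^+ 2 * s p.2 ^+ 2)).
  apply: ler_sum => p _; rewrite -exprMn.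
  by rewrite lerXn2r ?nnegrE ?mulr_ge0 ?entry_ge0.
apply: (@le_trans _ _ (\sum_(p <- (M `*` N)%fset) r p.1 ^+ 2 * s p.2 ^+ 2)).
  apply: sum_fset_sub => [p|p pF]; first by rewrite mulr_ge0 ?sqr_ge0.
  by rewrite in_fsetM !in_imfset.
rewrite (sum_fsetM M N (fun m n => r m ^+ 2 * s n ^+ 2)).
under eq_bigr do rewrite -mulr_sumr.
by rewrite -mulr_suml exprMn ler_pM// sumr_ge0// => *; rewrite sqr_ge0.
Qed.

End HilbertSchmidt.

(** * Inverses and commutators *)

Section Perturbation.
Context {R : realType} {H : completeNormedModType R[i]}.
Variables (E : int -> H -> H) (odE : orthogonal_decomposition E).
Implicit Types (X Y Z T U W : H -> H).
Local Notation hs_le := (hs_le E).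
Local Notation entry := (entry E).

(** Balls are closed for the operator norm, because each partial sum involves
finitely many entries and every entry is continuous for the operator norm. *)
Lemma hs_le_closed X c : bounded_op X -> 0 <= c ->
  (forall e : R, 0 < e -> exists2 Y, hs_le Y c &
    forall x, nrm (X x - Y x) <= e * nrm x) -> hs_le X c.
Proof.
move=> bX c0 approx; split=> // F; pose n := (size F)%:R : R.
have n0 : 0 <= n by rewrite ler0n.
have le_F e : 0 < e -> \sum_(p <- F) entry X p.1 p.2 ^+ 2 <= (c + e * n) ^+ 2.
  move=> e0; have [Y hY XY] := approx _ e0; have [bY _ hF] := hY.
  have hconst : \sum_(p <- F) e ^+ 2 <= (e * n) ^+ 2.
    rewrite big_const_seq count_predT iter_addr_0 -mulr_natr exprMn.
    rewrite ler_pM2l ?exprn_gt0// -natrX ler_nat.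
    by case: size => // k; rewrite leq_pmulr.
  apply: le_trans (sum_sqrD_le c0 (mulr_ge0 (ltW e0) n0) (hF F) hconst).
  apply: ler_sum => p _.
  rewrite lerXn2r ?nnegrE ?addr_ge0 ?entry_ge0 ?(ltW e0)//.
  apply: entry_le => [|x]; first by rewrite addr_ge0 ?entry_ge0 ?(ltW e0).
  rewrite -[X (E _ x)](subrK (Y (E p.2 x))) (linD (od_lin odE _)).
  rewrite (le_trans (nrmD _ _))// addrC mulrDl lerD ?le_entry//.
  rewrite (le_trans (od_contr1 odE _ _))// (le_trans (XY _))//.
  by rewrite ler_pM2l// od_contr1.
apply/ler_addgt0Pr => d d0.
pose k := 2 * c * n + n ^+ 2 + 1.
have k0 : 0 < k by rewrite ltr_wpDl ?addr_ge0 ?mulr_ge0 ?sqr_ge0.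
pose e := Num.min 1 (d / k).
have e0 : 0 < e by rewrite lt_min ltr01 divr_gt0.
have e1 : e <= 1 by rewrite ge_min lexx.
have ek : e * k <= d by rewrite -ler_pdivlMr// ge_min lexx orbT.
apply: le_trans (le_F _ e0) _.
have -> : (c + e * n) ^+ 2 = c ^+ 2 + e * (2 * c * n + e * n ^+ 2) by ring.
rewrite lerD2l (le_trans _ ek)// ler_pM2l// /k -addrA lerD2l.
by rewrite (le_trans (ler_wpM2r (sqr_ge0 n) e1))// mul1r lerDl.
Qed.

Lemma geometric_small (z C e : R) : 0 <= z < 1 -> 0 < e ->
  exists N, z ^+ N * C <= e.
Proof.
move=> /andP[z0 z1] e0.
have : z ^+ N * C @[N --> \oo] --> 0 * C.
  by apply: cvgMl; apply: cvg_expr; rewrite ger0_norm.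
rewrite mul0r => /cvgrPdist_le /(_ e e0) [N _ /(_ N (leqnn N))] /=.
by rewrite sub0r normrN => h; exists N; rewrite (le_trans (ler_norm _)).
Qed.

(** Iterating [X = Y + Z X] writes [X] as the sum of the first [N] terms of the
Neumann series applied to [Y], all in the ball of radius [y / (1 - z)], plus
[Z^N X], which tends to [0] in operator norm. *)
Lemma hs_le_fix_left X Y Z y z : bounded_op X -> hs_le Y y -> hs_le Z z ->
  z < 1 -> (forall x, X x = Y x + Z (X x)) -> hs_le X (y / (1 - z)).
Proof.
move=> bX hY hZ z1 XE; have [bY y0 _] := hY; have [bZ z0 _] := hZ.
have z1' : 0 < 1 - z by rewrite subr_gt0.
have y1 : 0 <= y / (1 - z) by exact: divr_ge0 y0 (ltW z1').
have iterate N : exists2 T, hs_le T (y / (1 - z)) &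
    forall x, nrm (X x - T x) <= z ^+ N * onrm X * nrm x.
  elim: N => [|N [T hT XT]].
    exists (fun=> 0); first exact: hs_le0.
    by move=> x; rewrite subr0 expr0 mul1r le_onrm.
  exists (fun x => Y x + Z (T x)).
    have := hs_leD odE hY (hs_leM odE hZ hT).
    by rewrite (_ : y + _ = y / (1 - z)) //; field; rewrite gt_eqF.
  move=> x; rewrite [X x]XE opprD addrACA subrr add0r -(linB (bounded_lin bZ)).
  rewrite (le_trans (hs_le_opnorm odE _ hZ))// exprS -!mulrA ler_wpM2l//.
  by rewrite mulrA XT.
apply: hs_le_closed => // e e0.
have [|N hN] := @geometric_small z (onrm X) e _ e0; first by rewrite z0.
have [T hT XT] := iterate N; exists T => // x.
by rewrite (le_trans (XT x))// ler_wpM2r ?nrm_ge0.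
Qed.

(** The mirror image of [hs_le_fix_left]; here the operator norm of [X Z^N] is
estimated by that of [X] times that of [Z^N]. *)
Lemma hs_le_fix_right X Y Z y z : bounded_op X -> hs_le Y y -> hs_le Z z ->
  z < 1 -> (forall x, X x = Y x + X (Z x)) -> hs_le X (y / (1 - z)).
Proof.
move=> bX hY hZ z1 XE; have [bY y0 _] := hY; have [bZ z0 _] := hZ.
have z1' : 0 < 1 - z by rewrite subr_gt0.
have y1 : 0 <= y / (1 - z) by exact: divr_ge0 y0 (ltW z1').
have iterate N : exists2 T, hs_le T (y / (1 - z)) &
    forall x, nrm (X x - T x) <= z ^+ N * onrm X * nrm x.
  elim: N => [|N [T hT XT]].
    exists (fun=> 0); first exact: hs_le0.
    by move=> x; rewrite subr0 expr0 mul1r le_onrm.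
  exists (fun x => Y x + T (Z x)).
    have := hs_leD odE hY (hs_leM odE hT hZ).
    by rewrite (_ : y + _ = y / (1 - z)) //; field; rewrite gt_eqF.
  move=> x; rewrite [X x]XE opprD addrACA subrr add0r.
  rewrite (le_trans (XT _))// exprSr -!mulrA ler_wpM2l ?exprn_ge0//.
  by rewrite mulrCA ler_wpM2l ?onrm_ge0// (hs_le_opnorm odE _ hZ).
apply: hs_le_closed => // e e0.
have [|N hN] := @geometric_small z (onrm X) e _ e0; first by rewrite z0.
have [T hT XT] := iterate N; exists T => // x.
by rewrite (le_trans (XT x))// ler_wpM2r ?nrm_ge0.
Qed.

Definition interval (l : nat) : {fset int} :=
  ([fset Posz k | k in iota 0 l] `|` [fset - Posz k | k in iota 0 l])%fset.

Lemma mem_interval l (m : int) : (absz m < l)%N -> m \in interval l.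
Proof.
move=> ml; rewrite in_fsetU; apply/orP; have [m0|m0] := leP 0 m; [left|right].
  apply/imfsetP; exists (absz m); last by rewrite gez0_abs.
  by rewrite /= mem_iota.
apply/imfsetP; exists (absz m); first by rewrite /= mem_iota.
by rewrite ltz0_abs// opprK.
Qed.

Lemma hs_le_block X l : bounded_op X ->
  (forall m n, ~~ ((absz m < l) && (absz n < l))%N -> entry X m n = 0) ->
  exists c, hs_le X c.
Proof.
move=> bX X0; pose K := (interval l `*` interval l)%fset.
pose S := \sum_(p <- K) entry X p.1 p.2 ^+ 2.
have S0 : 0 <= S by apply: sumr_ge0 => p _; exact: sqr_ge0.
exists (Num.sqrt S); split=> [//||F]; first exact: sqrtr_ge0.
rewrite sqr_sqrtr// (big_fsetID _ (fun p => p \in K) F) /= [X in _ + X]big_seq.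
rewrite [X in _ + X]big1 ?addr0.
  apply: sum_fset_sub => [p|p]; first exact: sqr_ge0.
  by rewrite !inE => /andP[].
move=> _ /imfsetP[/= p /andP[_ pK] ->]; rewrite X0 ?expr0n//.
by apply: contra pK => /andP[? ?]; rewrite in_fsetM !mem_interval.
Qed.

(** The level [l] is chosen so that the square it defines contains a finite set
carrying all but [e ^+ 2] of the square sum of [U]. *)
Lemma hs_le_tail U c (e : R) : hs_le U c -> 0 < e -> exists l, forall n X,
  (l <= n)%N -> bounded_op X -> (forall i j, entry X i j <= entry U i j) ->
  (forall i j, (absz i < n)%N -> (absz j < n)%N -> entry X i j = 0) ->
  hs_le X e.
Proof.
move=> [bU c0 hc] e0.
pose s (F : {fset int * int}) := \sum_(p <- F) entry U p.1 p.2 ^+ 2.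
have hs : has_sup (range s).
  split; first by exists (s fset0); exists fset0.
  by exists (c ^+ 2) => _ [F _ <-]; exact: hc.
have [_ [F0 _ <-] hF0] := sup_adherent (exprn_gt0 2 e0) hs.
pose l := (\max_(p <- F0) maxn (absz p.1) (absz p.2)).+1.
exists l => n X ln bX XU X0; split=> [//||F]; first exact: ltW.
have in_box p : p \in F0 -> (absz p.1 < n)%N && (absz p.2 < n)%N.
  move=> pF0; have := @leq_bigmax_seq _ (enum_fset F0) xpredT
    (fun p : int * int => maxn (absz p.1) (absz p.2)) p pF0 isT.
  rewrite geq_max => /andP[h1 h2].
  by rewrite !(leq_trans _ ln)// ltnS.
pose F' := [fset p in F | p \notin F0]%fset.
apply: (@le_trans _ _ (s F')).
  rewrite (big_fsetID _ (mem F0) F) /= [X in X + _]big_seq big1 ?add0r.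
    by apply: ler_sum => p _; rewrite lerXn2r ?nnegrE ?entry_ge0.
  move=> p; rewrite !inE /= => /andP[_ /in_box/andP[p1 p2]].
  by rewrite X0// expr0n.
have : s (F0 `|` F')%fset <= sup (range s).
  by apply: ub_le_sup; [case: hs|exists (F0 `|` F')%fset].
have -> : s (F0 `|` F')%fset = s F0 + s F'.
  rewrite {1}/s (big_fsetID _ (mem F0)) /=; congr (_ + _); apply: eq_fbigl.
    by move=> p; rewrite !inE /=; case: (p \in F0); rewrite ?andbT ?andbF.
  by move=> p; rewrite !inE /=; case: (p \in F0); rewrite ?andbT ?andbF.
by move: hF0; lra.
Qed.

(** [Pi l] is the sum of the [E m] with [absz m < l]. Prescribing its products
with the [E m] is equivalent and is what the estimates use. *)
Record cutoffs (Pi : nat -> H -> H) : Prop := {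
  cut_bounded : forall l, bounded_op (Pi l);
  cut_left : forall l m x,
    E m (Pi l x) = if (absz m < l)%N then E m x else 0;
  cut_right : forall l m x,
    Pi l (E m x) = if (absz m < l)%N then E m x else 0 }.

Variables (Pi : nat -> H -> H) (cutPi : cutoffs Pi).

Lemma hs_le_cut_right X l c : hs_le X c -> hs_le (X \o Pi l) c.
Proof.
move=> hX; have [bX _ _] := hX.
apply: (hs_le_entry _ hX) => [|m n].
  by apply: bounded_comp => //; exact: cut_bounded.
apply: entry_le => [|x /=]; first exact: entry_ge0.
rewrite cut_right//; case: ifP => _; first exact: le_entry.
rewrite (lin0 (bounded_lin bX)) (lin0 (od_lin odE _)) nrm0.
by rewrite mulr_ge0 ?entry_ge0 ?nrm_ge0.
Qed.

Lemma hs_le_compress T l : bounded_op T ->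
  exists c, hs_le (Pi l \o T \o Pi l) c.
Proof.
move=> bT; have bPi := cut_bounded cutPi l.
have bPT : bounded_op (Pi l \o T) by exact: bounded_comp.
apply: (@hs_le_block _ l); first exact: bounded_comp.
move=> m n mn; apply/eqP; rewrite eq_le entry_ge0 andbT entry_le// => x /=.
rewrite mul0r cut_left// cut_right//.
case: ifP mn => [_ /= /negPf ->|_ _]; last by rewrite nrm0.
by rewrite (lin0 (bounded_lin bT)) (lin0 (od_lin odE _)) nrm0.
Qed.

(** [W] stands for [(I + U)^-1 - I]. The norm of [W] cannot be bounded directly
by a Neumann series, as [U] may be large; but [U] becomes small after a finite
block [Pi U Pi] is removed, and the finite block costs only the columns
[W Pi], which are bounded beforehand by the same argument. *)
Lemma hs_le_inverse U W u : hs_le U u -> bounded_op W ->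
  (forall x, W x + U x + U (W x) = 0) -> (forall x, W x + U x + W (U x) = 0) ->
  exists w, hs_le W w.
Proof.
move=> hU bW UW WU; have [bU _ _] := hU.
have lU := bounded_lin bU; have lW := bounded_lin bW.
have half0 : 0 < 2^-1 :> R by rewrite invr_gt0 ltr0n.
have [l /(_ l _ (leqnn l)) small] := hs_le_tail hU half0.
have bPi := cut_bounded cutPi l.
have bPUP : bounded_op (Pi l \o U \o Pi l).
  exact: bounded_comp (bounded_comp bPi bU) bPi.
have entry_rest m n x : E m (Pi l (U (Pi l (E n x))) - U (E n x)) =
    if (absz m < l)%N && (absz n < l)%N then 0 else - E m (U (E n x)).
  rewrite (linB (od_lin odE _)) cut_left// cut_right//.
  case: (absz m < l)%N; case: (absz n < l)%N; rewrite /= ?subrr ?sub0r//.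
  by rewrite (lin0 lU) (lin0 (od_lin odE _)) sub0r.
pose Z x := Pi l (U (Pi l x)) - U x.
have hZ : hs_le Z 2^-1.
  apply: small => [|i j|i j il jl].
  - exact: bounded_sub.
  - apply: entry_le => [|x]; first exact: entry_ge0.
    rewrite entry_rest; case: ifP => _; last by rewrite nrmN le_entry.
    by rewrite nrm0 mulr_ge0 ?entry_ge0 ?nrm_ge0.
  - apply/eqP; rewrite eq_le entry_ge0 andbT entry_le// => x.
    by rewrite entry_rest il jl nrm0 mul0r.
have half1 : 2^-1 < 1 :> R by rewrite invf_lt1 ?ltr1n ?ltr0n.
(* [W Pi = - U Pi - Pi U Pi W Pi + Z (W Pi)] *)
have [b hb] : exists b, hs_le (W \o Pi l) b.
  have [c hc] : exists c, hs_le (Pi l \o (U \o Pi l \o W) \o Pi l) c.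
    exact: hs_le_compress (bounded_comp (bounded_comp bU bPi) bW).
  have hY := hs_leB odE (hs_leN odE (hs_le_cut_right l hU)) hc.
  exists ((u + c) / (1 - 2^-1)).
  apply: (hs_le_fix_left (bounded_comp bW bPi) hY hZ half1) => x /=.
  by rewrite /Z addrA subrK -opprD; apply/eqP; rewrite -addr_eq0 addrA UW.
(* [W = - (U + (W Pi) (U Pi)) + W Z] *)
have hY := hs_leN odE (hs_leD odE hU (hs_leM odE hb (hs_le_cut_right l hU))).
exists ((u + b * u) / (1 - 2^-1)); apply: (hs_le_fix_right bW hY hZ half1) => x.
rewrite /Z (linB lW) /= opprD addrA subrK -opprD.
by apply/eqP; rewrite -addr_eq0 addrA WU.
Qed.

Definition commutator U l : H -> H := fun x => U (Pi l x) - Pi l (U x).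

(** An entry of the commutator is [0] when both indices lie on the same side of
[l], and plus or minus an entry of [U] otherwise. *)
Lemma entry_commutator U l m n : bounded_op U ->
  entry (commutator U l) m n <= entry U m n /\
  ((absz m < l)%N -> (absz n < l)%N -> entry (commutator U l) m n = 0).
Proof.
move=> bU; have lE := od_lin odE m.
have entE x : E m (commutator U l (E n x)) =
    if (absz m < l)%N == (absz n < l)%N then 0
    else if (absz m < l)%N then - E m (U (E n x)) else E m (U (E n x)).
  rewrite /commutator (linB lE) cut_left// cut_right//.
  case: (absz m < l)%N; case: (absz n < l)%N; rewrite /= ?subrr ?subr0//.
    by rewrite (lin0 (bounded_lin bU)) (lin0 lE) sub0r.
  by rewrite (lin0 (bounded_lin bU)) (lin0 lE).
split=> [|ml nl].
  apply: entry_le => [|x]; first exact: entry_ge0.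
  rewrite entE; case: ifP => _; last by case: ifP => _; rewrite ?nrmN le_entry.
  by rewrite nrm0 mulr_ge0 ?entry_ge0 ?nrm_ge0.
apply/eqP; rewrite eq_le entry_ge0 andbT entry_le// => x.
by rewrite entE ml nl nrm0 mul0r.
Qed.

Lemma bounded_commutator U l : bounded_op U -> bounded_op (commutator U l).
Proof.
by move=> bU; apply: bounded_sub; apply: bounded_comp => //; exact: cut_bounded.
Qed.

Lemma hs_le_commutator U u l : hs_le U u -> hs_le (commutator U l) u.
Proof.
move=> hU; have [bU _ _] := hU; apply: (hs_le_entry _ hU) => [|m n].
  exact: bounded_commutator.
by have [] := entry_commutator l m n bU.
Qed.

Lemma commutator_small U u (e : R) : hs_le U u -> 0 < e ->
  exists l, forall n, (l <= n)%N -> hs_le (commutator U n) e.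
Proof.
move=> hU e0; have [bU _ _] := hU; have [l small] := hs_le_tail hU e0.
exists l => n ln; apply: small ln _ _ _ => [|i j|i j il jl].
- exact: bounded_commutator.
- by have [] := entry_commutator n i j bU.
- by have [_ ->] := entry_commutator n i j bU.
Qed.

(** With [V = (I + U)^-1], the difference [D n] is the commutator of [U] and
[Pi n] followed by [V = I + W], and [W] has finite norm. *)
Lemma conjugated_cutoff_cvg U V (D : nat -> H -> H) : S2 E U -> bounded_op V ->
  cancel (idplus U) V -> cancel V (idplus U) ->
  (forall n x, D n x = idplus U (Pi n (V x)) - Pi n x) ->
  (forall n, S2 E (D n)) /\ (fun n => Snorm E (D n)) @ \oo --> (0 : R).
Proof.
move=> /(S2_hs_le odE) hU bV UK VK DE; have [bU _ _] := hU.
have lU := bounded_lin bU; have lV := bounded_lin bV.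
pose W x := V x - x.
have bid : bounded_op (id : H -> H).
  by apply/bounded_opP; split=> //; exists 1 => // x; rewrite mul1r.
have bW : bounded_op W by exact: bounded_sub.
have UV x : U (V x) = x - V x.
  by rewrite -[X in X - _]VK /idplus addrC addKr.
have VU x : V (U x) = x - V x.
  by rewrite -[X in X - _]UK /idplus (linD lV) addrC addKr.
have [w hW] : exists w, hs_le W w.
  apply: (hs_le_inverse hU bW) => x; rewrite /W.
    by rewrite (linB lU) UV -opprB addrACA addNr add0r subrr.
  by rewrite VU -opprB addrACA addNr add0r subrr.
have [_ w0 _] := hW.
have D_eq n : D n = fun x => commutator U n x + commutator U n (W x).
  apply/funext => x; rewrite DE -(linD (bounded_lin (bounded_commutator n bU))).
  rewrite /W [x + _]addrC subrK /commutator /idplus UV.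
  by rewrite (linB (bounded_lin (cut_bounded cutPi n))) opprB addrCA addrA.
have hD n d : hs_le (commutator U n) d -> hs_le (D n) (d * (1 + w)).
  move=> hd; rewrite D_eq mulrDr mulr1.
  by have := hs_leD odE hd (hs_leM odE hd hW).
split=> [n|]; first exact (hs_le_S2 odE (hD _ _ (hs_le_commutator n hU))).
apply/cvgrPdist_le => e e0.
have w1 : 0 < 1 + w by rewrite ltr_wpDr.
have [l small] := commutator_small hU (divr_gt0 e0 w1).
exists l => // n /= /small /hD; rewrite divfK ?gt_eqF// => /(Snorm_le odE).
by rewrite sub0r normrN ger0_norm// sqrtr_ge0.
Qed.

End Perturbation.

(** * Projections onto unions of eigenspaces *)

#[local] Existing Instance totally_filter.

Section SpectralSums.
Context {R : realType} {H : completeNormedModType R[i]}.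
Context {ip : {dot H for Num.conj}}.
Hypothesis ipE : forall x : H, `|x| ^+ 2 = ip x x.
Variable P : int -> H -> H.
Hypothesis P_orth : forall n, orthogonal_projection ip (P n).
Hypothesis P_disj : forall m n, m != n -> forall x, P m (P n x) = 0.
Hypothesis P_sum : forall x, partial_sum (fun n => P n x) @ totally --> x.

Let P_bounded n : bounded_op (P n). Proof. by case: (P_orth n). Qed.
Let P_lin n : linear (P n). Proof. exact: bounded_lin. Qed.

Let P_comp m n x : P m (P n x) = if m == n then P n x else 0.
Proof.
by case: eqVneq => [->|/P_disj//]; have [_ -> _] := P_orth n.
Qed.

Lemma nrmD_sqr (x y : H) : ip x y = 0 -> ip y x = 0 ->
  nrm (x + y) ^+ 2 = nrm x ^+ 2 + nrm y ^+ 2.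
Proof.
move=> xy0 yx0; apply: (@complexI R).
rewrite rmorphD !rmorphXn /= -!normE !ipE.
by rewrite linearDl /= !linearDr /= xy0 yx0 addr0 add0r.
Qed.

Definition psum (D : pred int) (x : H) (F : {fset int}) : H :=
  \sum_(k <- F) if D k then P k x else 0.

Lemma partial_sumE D x F :
  partial_sum (fun k => if D k then P k x else 0) F = psum D x F.
Proof. by rewrite /psum big_seq_fsetE. Qed.

Lemma psum_orth D D' x F : (forall k, ~~ (D k && D' k)) ->
  ip (psum D x F) (psum D' x F) = 0.
Proof.
move=> DD'; rewrite linear_sumlz big1// => k _.
rewrite linear_sumr big1// => j _.
case: ifP => Dk; last by rewrite linear0l.
case: ifP => Dj; last by rewrite linear0r.
change (ip (P k x) (P j x) = 0).
have -> : ip (P k x) (P j x) = ip x (P k (P j x)) by have [_ _] := P_orth k.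
rewrite P_comp; case: eqVneq Dj => [<- D'k|_ _]; last by rewrite linear0r.
by have := DD' k; rewrite Dk D'k.
Qed.

Lemma psum_pyth D D' x F : (forall k, ~~ (D k && D' k)) ->
  nrm (psum (predU D D') x F) ^+ 2 =
  nrm (psum D x F) ^+ 2 + nrm (psum D' x F) ^+ 2.
Proof.
move=> DD'; rewrite -nrmD_sqr; last 2 first.
- exact: psum_orth.
- by apply: psum_orth => k; rewrite andbC.
rewrite /psum -big_split /=; congr (nrm _ ^+ 2); apply: eq_bigr => k _.
by have := DD' k; case: (D k); case: (D' k); rewrite ?addr0 ?add0r.
Qed.

Lemma psum_le D x F : nrm (psum D x F) <= nrm (psum xpredT x F).
Proof.
rewrite -(@ler_pXn2r _ 2)// ?nnegrE ?nrm_ge0//.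
have := @psum_pyth D (predC D) x F; rewrite /psum.
under eq_bigr do rewrite /= orbN.
by move=> -> => [|k /=]; [rewrite lerDl sqr_ge0|case: (D k)].
Qed.

Lemma psum_setD D x (F G : {fset int}) : (F `<=` G)%fset ->
  psum D x G - psum D x F = psum D x (G `\` F)%fset.
Proof.
move=> FG; rewrite /psum (big_fsetID _ (fun k => k \in F) G) /=.
rewrite (_ : [fset k | k in G & k \in F]%fset = F); last first.
  apply/fsetP => k; rewrite !inE /=; case: (boolP (k \in F)); rewrite ?andbF//.
  by move=> /(fsubsetP FG) ->.
rewrite addrAC subrr add0r; apply: eq_fbigl => k.
by rewrite !inE /= andbC.
Qed.

Lemma approx_psum x (e : R) : 0 < e -> exists F0 : {fset int},
  forall F, (F0 `<=` F)%fset -> nrm (x - psum xpredT x F) < e.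
Proof.
move=> e0; have e0' : 0 < e%:C :> R[i] by rewrite ltcR.
have /cvgrPdist_lt/(_ _ e0')[F0 _ hF] := @P_sum x.
exists F0 => F /hF /=; rewrite normE ltcR.
by rewrite (partial_sumE xpredT).
Qed.

(** By Pythagoras, dropping terms from a finite sum of the [P k x] decreases its
norm; the Cauchy property is thus inherited from the full series. *)
Lemma psum_cauchy D x : cvg (psum D x @ totally).
Proof.
apply/cauchy_cvgP/cauchy_exP => eps eps0.
have epsE : eps = (complex.Re eps)%:C by rewrite RRe_real// gtr0_real.
have e0 : 0 < complex.Re eps by rewrite -ltcR -epsE.
have [F0 hF] := approx_psum x (divr_gt0 e0 (ltr0n R 2)).
exists (psum D x F0); exists F0 => // F /= F0F.
rewrite -ball_normE /= epsE normE ltcR -nrmN opprB psum_setD//.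
rewrite (le_lt_trans (psum_le _ _ _))// -psum_setD//.
rewrite -(subrKA x) (le_lt_trans (nrmD _ _))// -nrmN opprB.
by rewrite [ltRHS]splitr ltrD// hF// fsubset_refl.
Qed.

Definition spec_proj D x : H :=
  summability.sum (fun k => if D k then P k x else 0).

Lemma cvg_spec_proj D x : psum D x F @[F --> totally] --> spec_proj D x.
Proof.
have -> : spec_proj D x = lim (psum D x @ totally).
  rewrite /spec_proj /summability.sum; congr (lim (_ @ totally)).
  apply/funext => F.
  exact: partial_sumE.
exact: psum_cauchy.
Qed.

Lemma P_spec_proj m D x : P m (spec_proj D x) = if D m then P m x else 0.
Proof.
have cvgP : P m (psum D x F) @[F --> totally] --> P m (spec_proj D x).
  apply: (@cvg_comp _ _ _ (psum D x) (P m)); first exact: cvg_spec_proj.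
  by have [_ cP] := P_bounded m; exact: cP.
apply: (cvg_unique (@norm_hausdorff _ _) cvgP).
apply: cvg_near_cst; exists [fset m]%fset => // F /= mF.
rewrite lin_sum// (bigD1_seq m) ?fset_uniq//=; last by rewrite -fsub1set.
rewrite big1 => [|k km].
  rewrite addr0; case: (D m); last by rewrite lin0.
  by rewrite P_comp eqxx.
by case: (D k); rewrite ?lin0// P_comp eq_sym (negPf km).
Qed.

(** Together with [P_spec_proj], this reduces identities between spectral
projections to Boolean identities between index sets. *)
Lemma P_ext x y : (forall m, P m x = P m y) -> x = y.
Proof.
move=> xy; apply: (cvg_unique (@norm_hausdorff _ _) (@P_sum x)).
by rewrite (_ : P^~ x = P^~ y); [exact: P_sum|exact/funext].
Qed.

Lemma spec_proj_lin D : linear (spec_proj D).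
Proof.
move=> a x y; apply: P_ext => m; rewrite P_lin !P_spec_proj.
by case: (D m); rewrite ?P_lin// scaler0 addr0.
Qed.

Lemma eq_spec_proj D D' x : D =1 D' -> spec_proj D x = spec_proj D' x.
Proof. by move=> /funext ->. Qed.

Lemma spec_proj_comp D D' x :
  spec_proj D (spec_proj D' x) = spec_proj (predI D D') x.
Proof. by apply: P_ext => m; rewrite !P_spec_proj /=; case: (D m). Qed.

Lemma spec_proj_predT x : spec_proj xpredT x = x.
Proof. by apply: P_ext => m; rewrite P_spec_proj. Qed.

Lemma spec_proj_pred0 x : spec_proj xpred0 x = 0.
Proof. by apply: P_ext => m; rewrite P_spec_proj lin0. Qed.

Lemma spec_proj_predU D D' x : (forall k, ~~ (D k && D' k)) ->
  spec_proj (predU D D') x = spec_proj D x + spec_proj D' x.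
Proof.
move=> DD'; apply: P_ext => m; rewrite linD// !P_spec_proj /=.
by have := DD' m; case: (D m); case: (D' m); rewrite ?addr0 ?add0r.
Qed.

Lemma spec_proj_predC D x : spec_proj (predC D) x = x - spec_proj D x.
Proof.
apply: P_ext => m; rewrite linB// !P_spec_proj /=.
by case: (D m); rewrite ?subrr ?subr0.
Qed.

Lemma spec_proj_pyth D D' x : (forall k, ~~ (D k && D' k)) ->
  nrm (spec_proj (predU D D') x) ^+ 2 =
  nrm (spec_proj D x) ^+ 2 + nrm (spec_proj D' x) ^+ 2.
Proof.
move=> DD'; apply: (@complexI R); rewrite rmorphD !rmorphXn /= -!normE.
have cv D0 : `|psum D0 x F| ^+ 2 @[F --> totally] --> `|spec_proj D0 x| ^+ 2.
  under eq_fun do rewrite expr2.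
  by rewrite expr2; apply: cvgM; apply: cvg_norm; exact: cvg_spec_proj.
apply: (cvg_unique (@norm_hausdorff _ _) (cv _)).
rewrite (_ : (fun F => _) =
    (fun F => `|psum D x F| ^+ 2 + `|psum D' x F| ^+ 2)).
  exact: cvgD.
apply/funext => F; rewrite !normE -!rmorphXn -rmorphD /=; congr (_%:C).
exact: psum_pyth.
Qed.

Lemma spec_proj_contr D x : nrm (spec_proj D x) <= nrm x.
Proof.
rewrite -[in leRHS](spec_proj_predT x) -(@ler_pXn2r _ 2)// ?nnegrE ?nrm_ge0//.
rewrite (@eq_spec_proj xpredT (predU D (predC D))); last first.
  by move=> k /=; rewrite orbN.
by rewrite spec_proj_pyth ?lerDl ?sqr_ge0// => k /=; case: (D k).
Qed.

Lemma spec_proj_bounded D : bounded_op (spec_proj D).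
Proof.
apply/bounded_opP; split; first exact: spec_proj_lin.
by exists 1 => // x; rewrite mul1r spec_proj_contr.
Qed.

Section Blocks.
(* [b] sends the index of an eigenvalue to the index of its block. *)
Variable b : int -> int.

Let block n : pred int := fun k => b k == n.
Let blocks (G : seq int) : pred int := fun k => b k \in G.

Let block_blocks n G : n \notin G -> forall k, ~~ (block n k && blocks G k).
Proof.
move=> nG k; apply/negP => -[/andP[/eqP bk]].
by rewrite /blocks bk (negPf nG).
Qed.

Let blocks_cons n G : blocks (n :: G) =1 predU (block n) (blocks G).
Proof. by move=> k; rewrite /blocks inE. Qed.

Lemma sum_blocks (G : seq int) x : uniq G ->
  \sum_(n <- G) spec_proj (block n) x = spec_proj (blocks G) x /\
  nrm (spec_proj (blocks G) x) ^+ 2 =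
    \sum_(n <- G) nrm (spec_proj (block n) x) ^+ 2.
Proof.
elim: G => [_|n G IH /= /andP[nG /IH[IH1 IH2]]].
  by rewrite !big_nil spec_proj_pred0 nrm0 expr0n.
rewrite !big_cons (eq_spec_proj _ (blocks_cons n G)) IH1 -IH2.
have disj := block_blocks nG.
by split; [rewrite spec_proj_predU|rewrite spec_proj_pyth].
Qed.

(** Totality: a finite sum of the [P k x] close to [x] involves finitely many
blocks, and the projection away from these blocks annihilates that sum. *)
Lemma blocks_decomposition :
  orthogonal_decomposition (fun n => spec_proj (block n)).
Proof.
split.
- by move=> n; exact: spec_proj_lin.
- move=> m n x; rewrite spec_proj_comp; case: eqVneq => [->|mn].
    by apply: eq_spec_proj => k /=; rewrite andbb.
  rewrite -(spec_proj_pred0 x); apply: eq_spec_proj => k /=.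
  apply/negP => /andP[/eqP bk].
  by rewrite /block bk (negPf mn).
- move=> G x; have [-> ->] // := sum_blocks x (fset_uniq G).
- move=> G x; have [-> _] := sum_blocks x (fset_uniq G).
  exact: spec_proj_contr.
- move=> x e e0; have [F /(_ F (fsubset_refl _)) hF] := approx_psum x e0.
  exists [fset b k | k in F]%fset.
  have [-> _] := sum_blocks x (fset_uniq [fset b k | k in F]%fset).
  rewrite -spec_proj_predC; apply: le_lt_trans hF.
  set C := predC _.
  rewrite (_ : spec_proj C x = spec_proj C (x - psum xpredT x F)).
    exact: spec_proj_contr.
  rewrite (linB (spec_proj_lin C)) [X in _ - X](_ : _ = 0) ?subr0//.
  rewrite (lin_sum (spec_proj_lin C)) big_seq big1// => k kF.
  apply: P_ext => m; rewrite P_spec_proj lin0// P_comp.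
  case: eqVneq => [->|]; last by rewrite if_same.
  by rewrite /C /= /blocks in_imfset.
Qed.

End Blocks.

End SpectralSums.

(** * Convergence of the spectral projections *)

Lemma inverse_onTE (R : realType) (H : completeNormedModType R[i])
    (T V : H -> H) : cancel T V -> cancel V T -> inverse_on setT T = V.
Proof.
move=> TK VK; apply/funext => y; rewrite -{1}[y]VK /inverse_on pinvKV ?inE//.
by move=> x z _ _; exact: can_inj TK x z.
Qed.

Theorem theorem4p14
  (R : realType) (H : completeNormedModType R[i]) (ip : {dot H for Num.conj})
  (ipE : forall x : H, `|x| ^+ 2 = ip x x)
  (separableH : exists2 S : set H, countable S & dense S)
  (A : linop H) (lam : int -> R[i]) (P : int -> H -> H)
  (hA : standing_assumptions ip A lam P)
  (sigma : int -> set R[i])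
  (hsigma : partition [set: int] sigma (spectrum A))
  (Q : H -> H) (hQ : S2 (block_proj lam P sigma) Q)
  (hQl : forall l : nat,
     Psum (block_proj lam P sigma) l \o Q \o Psum (block_proj lam P sigma) l
     <> Q)
  (B : linop H) (hB : rel_bounded A B)
  (U : H -> H) (hU : MQ (block_proj lam P sigma) Q U)
  (hUinv : continuously_invertible (idplus U))
  (hUdom : idplus U @` dom A = dom A)
  (V : linop H) (hVdom : dom V = dom A)
  (hsim : forall x, dom A x ->
     A (idplus U x) - B (idplus U x) = idplus U (A x - V x))
  (hV : forall m n, m != n -> forall x, dom V (block_proj lam P sigma n x) ->
     block_proj lam P sigma m (V (block_proj lam P sigma n x)) = 0)
  (hsmall : Snorm (block_proj lam P sigma) U < 1 \/
     range sigma = [set [set z] | z in spectrum A]) :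
  let Sigma_norm := Snorm (block_proj lam P sigma) in
  let Ptau tau := proj_on lam P tau in
  let Pprime tau := perturbed_proj U (Ptau tau) in
  let diff tau := fun x => Pprime tau x - Ptau tau x in
  [/\ forall n, S2 (block_proj lam P sigma)
        (diff (spectrum A `\` sigma_tail A sigma n)),
      forall n, S2 (block_proj lam P sigma) (diff (sigma_tail A sigma n)),
      (fun n => Sigma_norm (diff (spectrum A `\` sigma_tail A sigma n)))
        @ \oo --> (0 : R) &
      (fun n => Sigma_norm (diff (sigma_tail A sigma n))) @ \oo --> (0 : R)].
Proof.
case: hUinv => V0 [bV0 UK VK].
have [_ _ _ Esp _ _ _ _ P_orth P_disj P_sum _ _] := hA.
have [covS trivS _] := hsigma.
have exb k : exists n, sigma n (lam k).
  have : spectrum A (lam k) by rewrite Esp; exists k.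
  by rewrite -covS => -[n _ ?]; exists n.
have [b bP] := choice exb.
have sigmaE n k : `[<sigma n (lam k)>] = (b k == n).
  apply/asboolP/eqP => [nk|<-//].
  by apply: (trivS (b k) n) => //; exists (lam k); split.
pose E n := spec_proj P (fun k => b k == n).
have EE : block_proj lam P sigma = E.
  apply/funext => n; apply/funext => x; apply: eq_spec_proj => k.
  exact: sigmaE.
pose Pi (l : nat) := spec_proj P (fun k => (absz (b k) < l)%N).
have tailE n k : sigma_tail A sigma n (lam k) <-> ~~ (absz (b k) < n)%N.
  split=> [[_]|kn].
    by apply: contra_notN => kn; exists (b k).
  split; first by rewrite Esp; exists k.
  move=> [m mn /asboolP]; rewrite sigmaE => /eqP bkm.
  by move: kn; rewrite bkm; apply/negP/negPn.
have headE n : proj_on lam P (spectrum A `\` sigma_tail A sigma n) = Pi n.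
  apply/funext => x; apply: eq_spec_proj => k.
  apply/asboolP/idP => [[_ /(contra_not (tailE n k).2) /negP/negPn//]|kn].
  split; first by rewrite Esp; exists k.
  by move=> /tailE; rewrite kn.
have tailPE n x : proj_on lam P (sigma_tail A sigma n) x = x - Pi n x.
  rewrite -(spec_proj_predC ipE P_orth P_disj P_sum).
  apply: eq_spec_proj => k /=.
  by apply/asboolP/idP => /tailE.
have odE : orthogonal_decomposition E.
  exact (blocks_decomposition ipE P_orth P_disj P_sum b).
have cutPi : cutoffs E Pi.
  split=> [l|l m x|l m x].
  - exact (spec_proj_bounded ipE P_orth P_disj P_sum _).
  - rewrite /E /Pi (spec_proj_comp ipE P_orth P_disj P_sum); case: ifP => ml.
      by apply: eq_spec_proj => k /=; case: eqVneq => //= ->.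
    rewrite -(spec_proj_pred0 ipE P_orth P_disj P_sum x).
    apply: eq_spec_proj => k /=.
    by case: eqVneq => //= ->.
  - rewrite /E /Pi (spec_proj_comp ipE P_orth P_disj P_sum); case: ifP => ml.
      by apply: eq_spec_proj => k /=; rewrite andbC; case: eqVneq => //= ->.
    rewrite -(spec_proj_pred0 ipE P_orth P_disj P_sum x).
    apply: eq_spec_proj => k /=.
    by rewrite andbC; case: eqVneq => //= ->.
rewrite EE in hU *; have [SU _] := hU.
move=> Sigma_norm Ptau Pprime diff.
have diff_head n :
    diff (spectrum A `\` sigma_tail A sigma n) =
    fun x => idplus U (Pi n (V0 x)) - Pi n x.
  rewrite /diff /Pprime /Ptau /perturbed_proj (inverse_onTE UK VK) headE.
  by [].
have diff_tail n : diff (sigma_tail A sigma n) =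
    fun x => - diff (spectrum A `\` sigma_tail A sigma n) x.
  rewrite diff_head; apply/funext => x.
  rewrite /diff /Pprime /Ptau /perturbed_proj (inverse_onTE UK VK) /= !tailPE.
  have [[lU _] _] := SU.
  rewrite /idplus (linB lU) addrACA -opprD -[V0 x + U (V0 x)]/(idplus U _) VK.
  by rewrite !opprB [LHS]addrC [LHS]addrA subrK.
have [S2D cvgD] :
    (forall n, S2 E (diff (spectrum A `\` sigma_tail A sigma n))) /\
    (fun n => Sigma_norm (diff (spectrum A `\` sigma_tail A sigma n)))
      @ \oo --> (0 : R).
  apply: (conjugated_cutoff_cvg odE cutPi SU bV0 UK VK) => n x.
  by rewrite diff_head.
clearbody diff.
split.
- exact S2D.
- by move=> n; rewrite diff_tail; exact (S2N odE (S2D n)).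
- exact cvgD.
rewrite (_ : (fun n => _) =
    fun n => Sigma_norm (diff (spectrum A `\` sigma_tail A sigma n))).
  exact cvgD.
by apply/funext => n; rewrite diff_tail; exact (SnormN odE (S2D n)).
Qed.
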